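(* Let $d\ge1$ be an integer, let $\mu\in\mathcal M(\mathcal S_d)$ and let $\tau:(0,1)\to(0,+\infty)$ be nonincreasing with $\lim_{x\to0^+}\tau(x)=+\infty$. Define $$\mathcal E(\tau,\mu)=\Big\{y\in\mathcal S_d:\ \limsup_{r\to1^-}\frac{|P[\mu](ry)|}{\tau(1-r)}=+\infty\Big\}.$$ Let $\phi:(0,+\infty)\to(0,+\infty)$ be a dimension function satisfying $\phi(s)=O(\tau(s)s^d)$ as $s\to0^+$. Then $$\mathcal H^{\phi}\big(\mathcal E(\tau,\mu)\big)=0.$$
   Context: $\mathcal S_d$ is the Euclidean unit sphere of $\mathbb R^{d+1}$ with the metric inherited from the Euclidean norm $\|\cdot\|$ of $\mathbb R^{d+1}$, and $\mathcal M(\mathcal S_d)$ is the set of complex Borel measures on $\mathcal S_d$. For $x$ in the open unit ball and $\xi\in\mathcal S_d$, the Poisson kernel is $P(x,\xi)=\frac{1-\|x\|^2}{\|x-\xi\|^{d+1}}$, and $P[\mu](x)=\int_{\mathcal S_d}P(x,\xi)\,d\mu(\xi)$. A dimension function is a continuous nondecreasing function $\phi:[0,+\infty)\to[0,+\infty)$ with $\phi(0)=0$ (a dimension function given on $(0,+\infty)$ is extended by $\phi(0)=0$). For $E\subset\mathcal S_d$, the $\phi$-Hausdorff outer measure is $$\mathcal H^{\phi}(E)=\lim_{\varepsilon\to0}\ \inf_{\mathcal R\in R_\varepsilon(E)}\ \sum_{B\in \mathcal R}\phi(|B|),$$ where $R_\varepsilon(E)$ is the set of countable coverings of $E$ by balls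 $B$ of diameter $|B|\le\varepsilon$. *)

(* Defs.v *)
(* MathComp-Analysis *)
From HB Require Import structures.
From mathcomp Require Import all_boot all_order all_algebra.
From mathcomp Require Import all_classical all_reals all_analysis.
From mathcomp Require Import complex ring.

Set Implicit Arguments.
Unset Strict Implicit.
Unset Printing Implicit Defensive.

Import Order.TTheory GRing.Theory Num.Theory.
Import numFieldNormedType.Exports.

Local Open Scope classical_set_scope.
Local Open Scope ring_scope.

(* The library's norm `|x| on 'rV[R]_n is the sup norm, hence the separate
   Euclidean norm. *)
Section euclidean_norm.
Context {R : realType} {n : nat}.
Implicit Types x y z : 'rV[R]_n.

Definition enorm x : R := Num.sqrt (\sum_i x ord0 i ^+ 2).

Let sumsq_ge0 x : 0 <= \sum_i x ord0 i ^+ 2.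
Proof. by apply: sumr_ge0 => i _; rewrite sqr_ge0. Qed.

Lemma enorm_ge0 x : 0 <= enorm x.
Proof. exact: sqrtr_ge0. Qed.

Lemma enorm0 : enorm 0 = 0.
Proof.
by rewrite /enorm big1 ?sqrtr0// => i _; rewrite mxE expr0n.
Qed.

Lemma enorm_eq0 x : enorm x = 0 -> x = 0.
Proof.
move/eqP; rewrite sqrtr_eq0 => x0.
have /eqP : \sum_i x ord0 i ^+ 2 = 0.
  by apply/eqP; rewrite eq_le x0 sumsq_ge0.
rewrite psumr_eq0; last by move=> i _; rewrite sqr_ge0.
move=> /allP h; apply/rowP => i; rewrite mxE.
by have := h i (mem_index_enum i); rewrite /= sqrf_eq0 => /eqP.
Qed.

Lemma enormN x : enorm (- x) = enorm x.
Proof.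
by rewrite /enorm; congr Num.sqrt; apply: eq_bigr => i _; rewrite mxE sqrrN.
Qed.

Let cauchy_schwarz x y :
  (\sum_i x ord0 i * y ord0 i) ^+ 2 <=
  (\sum_i x ord0 i ^+ 2) * (\sum_i y ord0 i ^+ 2).
Proof.
set a := fun i => x ord0 i; set b := fun i => y ord0 i.
have : 0 <= \sum_i \sum_j (a i * b j - a j * b i) ^+ 2.
  by apply: sumr_ge0 => i _; apply: sumr_ge0 => j _; rewrite sqr_ge0.
have -> : \sum_i \sum_j (a i * b j - a j * b i) ^+ 2 =
    2 * ((\sum_i a i ^+ 2) * (\sum_i b i ^+ 2) - (\sum_i a i * b i) ^+ 2).
  transitivity (\sum_i \sum_j (a i ^+ 2 * b j ^+ 2)
      + \sum_i \sum_j (b i ^+ 2 * a j ^+ 2)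
      - 2 * \sum_i \sum_j ((a i * b i) * (a j * b j))).
    rewrite mulr_sumr -big_split/= -sumrB; apply: eq_bigr => i _.
    rewrite mulr_sumr -big_split/= -sumrB; apply: eq_bigr => j _.
    by rewrite sqrrB !exprMn mulr2n; ring.
  rewrite [in RHS]expr2 !big_distrlr/=.
  rewrite (exchange_big_dep predT)//=.
  have -> : \sum_i \sum_j (b i ^+ 2 * a j ^+ 2) =
            \sum_i \sum_j (a i ^+ 2 * b j ^+ 2).
    rewrite exchange_big/=; apply: eq_bigr => i _; apply: eq_bigr => j _.
    by rewrite mulrC.
  by rewrite exchange_big/=; ring.
by rewrite pmulr_rge0// subr_ge0.
Qed.

Lemma ler_enormD x y : enorm (x + y) <= enorm x + enorm y.
Proof.
rewrite -(@ler_pXn2r _ 2)// ?nnegrE ?addr_ge0 ?enorm_ge0//.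
rewrite sqr_sqrtr ?sumsq_ge0// sqrrD !sqr_sqrtr ?sumsq_ge0//.
have -> : \sum_i (x + y) ord0 i ^+ 2 =
  \sum_i x ord0 i ^+ 2 + (\sum_i x ord0 i * y ord0 i) *+ 2
  + \sum_i y ord0 i ^+ 2.
  rewrite -sumrMnl -!big_split/=; apply: eq_bigr => i _.
  by rewrite mxE sqrrD.
rewrite lerD2r lerD2l lerMn2r/= -sqrtrM ?sumsq_ge0//.
by rewrite (le_trans (ler_norm _))// -sqrtr_sqr ler_wsqrtr.
Qed.

End euclidean_norm.

Definition sphere (R : realType) (d : nat) : Type :=
  {x : 'rV[R]_d.+1 | enorm x == 1}.

Section sphere_instances.
Context {R : realType} {d : nat}.
Implicit Types x y z : sphere R d.

HB.instance Definition _ := Choice.on (sphere R d).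

Let north_pole_subproof : enorm (delta_mx 0 0 : 'rV[R]_d.+1) == 1.
Proof.
rewrite /enorm (bigD1 ord0)//= big1.
  by rewrite mxE/= expr1n addr0 sqrtr1.
by move=> i i0; rewrite mxE (negbTE i0) andbF expr0n.
Qed.

Definition north_pole : sphere R d := 
  exist (fun x : 'rV[R]_d.+1 => enorm x == 1) _ north_pole_subproof.

HB.instance Definition _ := isPointed.Build (sphere R d) north_pole.

Definition sphere_dist x y : R := enorm (val x - val y).

Let sphere_distxx x : sphere_dist x x = 0.
Proof. by rewrite /sphere_dist subrr enorm0. Qed.

Let sphere_dist_positivity x y : sphere_dist x y = 0 -> x = y.
Proof. by move/enorm_eq0/eqP; rewrite subr_eq0 => /eqP/val_inj. Qed.

Let sphere_dist_sym x y : sphere_dist x y = sphere_dist y x.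
Proof. by rewrite /sphere_dist -enormN opprB. Qed.

Let sphere_dist_triangle y x z :
  sphere_dist x z <= sphere_dist x y + sphere_dist y z.
Proof.
by rewrite /sphere_dist (le_trans _ (ler_enormD _ _))// addrA subrK.
Qed.

HB.instance Definition _ := isMetric.Build R (sphere R d)
  sphere_distxx sphere_dist_positivity sphere_dist_sym sphere_dist_triangle.

End sphere_instances.

Notation borel T := (g_sigma_algebraType (@open T)).

(* Values on nonmeasurable sets are irrelevant. That the measure of the empty
   set is 0 follows from sigma-additivity, see cmeasure0 below. *)
Record complex_measure {d : measure_display} (T : measurableType d)
    (R : realType) := ComplexMeasure {
  cmeasure :> set T -> R[i] ;
  cmeasure_sigma_additive : forall F : nat -> set T,
    (forall i, measurable (F i)) -> trivIset setT F ->
    ((fun n => \sum_(0 <= i < n) cmeasure (F i)) : nat -> R[i]^o) @ \oo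
      --> (cmeasure (\bigcup_n F n) : R[i]^o) }.

Lemma cmeasure0 {d : measure_display} (T : measurableType d) (R : realType)
    (mu : complex_measure T R) : mu set0 = 0.
Proof.
set c := mu set0.
have cc : (fun n => (c *+ n : R[i]^o)) @ \oo --> (c : R[i]^o).
  have := @cmeasure_sigma_additive _ _ _ mu (fun=> set0) (fun=> measurable0)
    (@trivIset_set0 _ _ _).
  rewrite bigcup0//.
  suff -> : (fun n => \sum_(0 <= i < n) mu set0) = (fun n => c *+ n) by [].
  by apply/funext => n; rewrite sumr_const_nat subn0.
have cS : (fun n => (c *+ n.+1 : R[i]^o)) @ \oo --> (c : R[i]^o).
  by move: cc; rewrite -(cvg_shiftS (fun n => (c *+ n : R[i]^o))).
have : (fun n => (c *+ n.+1 - c *+ n : R[i]^o)%R) @ \oo --> (c - c : R[i]^o)%R.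
  exact: (@cvgB _ R[i]^o).
under eq_fun do rewrite mulrS addrK.
rewrite subrr => /(cvg_lim (@norm_hausdorff _ R[i]^o)) <-.
by rewrite lim_cst//; exact: (@norm_hausdorff _ R[i]^o).
Qed.

Section complex_measure_integral.
Context {d : measure_display} {T : measurableType d} {R : realType}.
Variable mu : complex_measure T R.
Local Open Scope ereal_scope.

Definition re_part (A : set T) : \bar R := (complex.Re (mu A))%:E.
Definition im_part (A : set T) : \bar R := (complex.Im (mu A))%:E.

Let normc_lt_Re (z : R[i]) (e : R) :
  (`|z| < e%:C%C -> `|complex.Re z| < e)%R.
Proof. by rewrite -ltcR; apply: le_lt_trans; exact: normc_ge_Re. Qed.

Let normc_lt_Im (z : R[i]) (e : R) :
  (`|z| < e%:C%C -> `|complex.Im z| < e)%R.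
Proof.
case: z => a b; have := @normc_lt_Re (b -i* a)%C e => /=.
by rewrite !normc_def/= sqrrN addrC.
Qed.

Let cvg_ReIm (u : nat -> R[i]) (l : R[i]) :
  (u : nat -> R[i]^o) @ \oo --> (l : R[i]^o) ->
  (fun n => complex.Re (u n)) @ \oo --> complex.Re l /\
  (fun n => complex.Im (u n)) @ \oo --> complex.Im l.
Proof.
move=> /(@cvgrPdist_lt _ R[i]^o) ul; split; apply/cvgrPdist_lt => e e0.
- have e0' : (0 < e%:C%C :> R[i])%R by rewrite ltcR.
  apply: filterS (ul _ e0') => n /normc_lt_Re.
  by case: (l) => ? ?; case: (u n).
- have e0' : (0 < e%:C%C :> R[i])%R by rewrite ltcR.
  apply: filterS (ul _ e0') => n /normc_lt_Im.
  by case: (l) => ? ?; case: (u n).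
Qed.

Let sum_ReIm (F : nat -> set T) n :
  \sum_(0 <= i < n) re_part (F i) =
    (complex.Re (\sum_(0 <= i < n) mu (F i))%R)%:E /\
  \sum_(0 <= i < n) im_part (F i) =
    (complex.Im (\sum_(0 <= i < n) mu (F i))%R)%:E.
Proof.
elim: n => [|n [IHr IHi]]; first by rewrite !big_geq.
rewrite !big_nat_recr//= IHr IHi /re_part /im_part -!EFinD.
by case: (\sum_(0 <= i < n) mu (F i))%R => ? ?; case: (mu (F n)).
Qed.

Let re_sigma_additive : semi_sigma_additive re_part.
Proof.
move=> F mF tF _; under eq_fun do rewrite (sum_ReIm F _).1.
apply: cvg_EFin; first exact: nearW.
exact: (cvg_ReIm (cmeasure_sigma_additive mF tF)).1.
Qed.

Let im_sigma_additive : semi_sigma_additive im_part.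
Proof.
move=> F mF tF _; under eq_fun do rewrite (sum_ReIm F _).2.
apply: cvg_EFin; first exact: nearW.
exact: (cvg_ReIm (cmeasure_sigma_additive mF tF)).2.
Qed.

Let re_part0 : re_part set0 = 0.
Proof. by rewrite /re_part cmeasure0. Qed.

Let im_part0 : im_part set0 = 0.
Proof. by rewrite /im_part cmeasure0. Qed.

Let re_part_fin A : measurable A -> re_part A \is a fin_num.
Proof. by []. Qed.

Let im_part_fin A : measurable A -> im_part A \is a fin_num.
Proof. by []. Qed.

HB.instance Definition _ := @isCharge.Build d T R re_part
  re_part0 re_part_fin re_sigma_additive.
HB.instance Definition _ := @isCharge.Build d T R im_part
  im_part0 im_part_fin im_sigma_additive.

End complex_measure_integral.

Section integral.
Context {d : measure_display} {T : measurableType d} {R : realType}.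

(* The value does not depend on the Hahn decomposition that is picked: any two
   of them have the same positive and negative variations. *)
Definition charge_integral (nu : {charge set T -> \bar R}) (f : T -> R) : R :=
  let P := cid (Hahn_decomposition nu) in
  let N := cid (svalP P) in
  \int[jordan_pos (svalP N)]_x f x - \int[jordan_neg (svalP N)]_x f x.

(* Only real-valued integrands are needed. *)
Definition complex_integral (mu : complex_measure T R) (f : T -> R) : R[i] :=
  (charge_integral (re_part mu) f +i* charge_integral (im_part mu) f)%C.

End integral.

Section poisson.
Context {R : realType} {d : nat}.

Definition poisson_kernel (x : 'rV[R]_d.+1) (xi : sphere R d) : R :=
  (1 - enorm x ^+ 2) / enorm (x - val xi) ^+ d.+1.

Definition poisson (mu : complex_measure (borel (sphere R d)) R)
    (x : 'rV[R]_d.+1) : R[i] :=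
  complex_integral mu (poisson_kernel x).

Definition divergence_set (tau : R -> R)
    (mu : complex_measure (borel (sphere R d)) R) : set (sphere R d) :=
  [set y | limf_esup
     (fun r : R => (Normc.normc (poisson mu (r *: val y)) / tau (1 - r))%:E)
     (1 : R)^'- = +oo%E].

End poisson.

Section hausdorff_measure.
Context {R : realType}.

Definition dimension_function (phi : R -> R) : Prop :=
  [/\ {within `[0, +oo[, continuous phi},
      {in `[0, +oo[ &, {homo phi : s t / s <= t}},
      {in `[0, +oo[, forall s, 0 <= phi s}
    & phi 0 = 0].

Context {T : metricType R}.
Implicit Types (A B E : set T) (phi : R -> R) (eps : R).

(* Only meant for nonempty bounded sets, such as balls: [sup] is 0 on sets of
   reals that are empty or unbounded. *)
Definition diameter A : R := sup [set mdist x y | x in A & y in A].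

(* A covering is a countable set of open balls, possibly finite or empty. *)
Definition ball_coverings eps E : set (set (set T)) :=
  [set C | [/\ countable C,
               forall B, C B ->
                 (exists x r, 0 < r /\ B = ball x r) /\ diameter B <= eps
             & E `<=` \bigcup_(B in C) B]].

Definition hausdorff_premeasure phi eps E : \bar R :=
  ereal_inf [set \esum_(B in C) (phi (diameter B))%:E
            | C in ball_coverings eps E].

Definition hausdorff_measure phi E : \bar R :=
  lim (hausdorff_premeasure phi eps E @[eps --> 0^'+]).

Lemma is_cvg_hausdorff_premeasure phi E :
  cvg (hausdorff_premeasure phi eps E @[eps --> 0^'+]).
Proof.
apply: nonincreasing_at_right_is_cvge; apply: nearW => x e1 e2 _ _ e12.
apply: ereal_inf_le_tmp => _ [C [cC bC EC] <-]; exists C => //; split => //.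
by move=> B /bC[? dB]; split=> //; exact: le_trans e12.
Qed.

End hausdorff_measure.

(* Main.v *)
(* Let [nu] be a finite positive measure dominating [mu].  Cutting the sphere
   into dyadic shells around [y] bounds [P[nu](r y)], with [s = 1 - r], by a
   constant times the supremum over [k] of [nu (B(y, 2^k s)) / (2^k s)^d].  Hence
   if [P[mu](r y) > C M tau(s)] then some [rho = 2^k s >= s] satisfies
   [nu (B(y, rho)) > M tau(s) rho^d >= M tau(rho) rho^d]; as [nu] is finite and
   [tau(s)] is large, [rho] is small.  Vitali's lemma extracts disjoint balls
   [B(y_i, rho_i)] whose threefold dilations cover the divergence set, and since
   [phi(6 rho) <= K tau(6 rho) (6 rho)^d <= 6^d K tau(rho) rho^d], the sum of
   the [phi(6 rho_i)] is at most [6^d K / M] times the mass of [nu], with [M]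
   arbitrarily large. *)
Require Import Defs.
From mathcomp Require Import all_boot all_order all_algebra.
From mathcomp Require Import all_classical all_reals all_analysis.
From mathcomp Require Import measurable_realfun finmap complex ring lra.
Import Order.TTheory GRing.Theory Num.Theory.
Import numFieldNormedType.Exports.
Local Open Scope classical_set_scope.
Local Open Scope ring_scope.

(** * Selection of disjoint sets *)

(* Federer's argument: apply Zorn's lemma to the disjoint subfamilies [G] such
   that every set meeting [G] meets a member of [G] of at least half its
   radius. *)
Lemma vitali_selection {R : realType} {I T : Type} (B : I -> set T)
    (rad : I -> R) (V : set I) (delta : R) :
  (forall i, V i -> B i !=set0) ->
  (forall i, V i -> 0 < rad i) ->
  (forall i, V i -> rad i <= delta) ->
  exists G : set I, [/\ G `<=` V, trivIset G B &
    forall i, V i ->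
      exists j, [/\ G j, B i `&` B j !=set0 & rad i <= 2 * rad j]].
Proof.
move=> B0 rad0 radD.
pose meets i G := exists2 j, G j & B i `&` B j !=set0.
pose P (G : set I) := [/\ G `<=` V, trivIset G B &
  forall i, V i -> meets i G ->
    exists j, [/\ G j, B i `&` B j !=set0 & rad i <= 2 * rad j]].
have chain (F : set (set I)) : F `<=` P -> total_on F subset ->
    P (\bigcup_(X in F) X).
  move=> FP tF; split.
  - by move=> i [X FX Xi]; have [+ _ _] := FP _ FX; exact.
  - move=> i j [X FX Xi] [Y FY Yj].
    have [XY|YX] := tF _ _ FX FY.
    + by have [_ + _] := FP _ FY; apply => //; exact: XY.
    + by have [_ + _] := FP _ FX; apply => //; exact: YX.
  - move=> i Vi [j [X FX Xj] ij].
    have [_ _ /(_ i Vi) []] := FP _ FX; first by exists j.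
    by move=> k [Xk ik rik]; exists k; split => //; exists X.
have [G [[GV tG dG] maxG]] := Zorn_bigcup chain.
exists G; split => // i0 Vi0; apply: (dG) => //; apply: contrapT => Ni0.
(* Among the members meeting no set of [G], one whose radius exceeds half the supremum [s] of their
   radii can be added to [G], against maximality: every newly met set has radius at most [s]. *)
pose V' := [set i | V i /\ ~ meets i G].
have rV' : has_sup (rad @` V').
  split; first by exists (rad i0), i0.
  by exists delta => _ [i [Vi _] <-]; exact: radD.
pose s := sup (rad @` V').
have s0 : 0 < s.
  apply: lt_le_trans (rad0 _ Vi0) _.
  by apply: sup_upper_bound => //; exists i0.
have [_ [i1 [Vi1 Ni1] <-] si1] : exists2 t, (rad @` V') t & s / 2 < t.
  have /(sup_adherent)/(_ rV') [t Vt] : 0 < s / 2 by rewrite divr_gt0.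
  by rewrite -/s => st; exists t => //; lra.
have NGi1 : ~ G i1.
  move=> Gi1; apply: Ni1; exists i1 => //.
  by rewrite setIid; exact: B0.
apply: (maxG (G `|` [set i1])).
  split; first by left.
  by move=> /(_ i1 (or_intror erefl)).
split.
- by move=> i [/GV//|->].
- move=> i j [Gi|->] [Gj|->] ij //; first exact: tG.
  + by exfalso; apply: Ni1; exists i => //; rewrite setIC.
  + by exfalso; apply: Ni1; exists j.
- move=> i Vi [k Gk ik]; have [mi|Ni] := pselect (meets i G).
    have [j [Gj ij rij]] := dG _ Vi mi.
    by exists j; split => //; left.
  case: Gk ik => [Gk ik|-> ii1]; first by exfalso; apply: Ni; exists k.
  exists i1; split => //; first by right.
  have ri : rad i <= s by apply: sup_upper_bound => //; exists i.
  lra.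
Qed.

(** * Disjoint families in a finite measure *)

Section disjoint_families.
Local Open Scope ereal_scope.
Context {d : measure_display} {T : measurableType d} {R : realType}
  (nu : {measure set T -> \bar R}).

Lemma esum_trivIset_le {J : choiceType} (D : set J) (F : J -> set T) :
  (forall j, D j -> measurable (F j)) -> trivIset D F ->
  \esum_(j in D) nu (F j) <= nu setT.
Proof.
move=> mF tF; apply: ge_ereal_sup => _ [A [finA AD] <-].
rewrite -measure_fin_bigcup//; last 2 first.
- exact: sub_trivIset tF.
- by move=> j /AD; exact: mF.
apply: le_measure => //; apply/mem_set => //.
by apply: fin_bigcup_measurable => // j /AD; exact: mF.
Qed.

(** [D] is the union over n of the classes of mass at least 1/(n+1), each finite by disjointness. *)
Lemma countable_trivIset {J : choiceType} (D : set J) (F : J -> set T) :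
  nu setT < +oo ->
  (forall j, D j -> measurable (F j)) -> trivIset D F ->
  (forall j, D j -> 0 < nu (F j)) -> countable D.
Proof.
move=> nuoo mF tF nu0.
pose D_ n := [set j | D j /\ (n.+1%:R^-1)%:E <= nu (F j)].
have -> : D = \bigcup_n D_ n.
  apply/seteqP; split=> [j Dj|j [n _ []//]].
  have := nu0 _ Dj; case E : (nu (F j)) => [r| |]//.
    rewrite lte_fin => /ltr_add_invr[n]; rewrite add0r => nr.
    by exists n => //; split; rewrite // E lee_fin ltW.
  by move=> _; exists 0%N => //; split; rewrite // E leey.
apply: bigcup_countable => // n _; apply: finite_set_countable.
apply: contrapT => infD.
have nufin : nu setT \is a fin_num by rewrite ge0_fin_numE.
(* [m] disjoint sets of mass at least 1/(n+1) would outweigh the whole space. *)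
pose m := (Num.trunc (fine (nu setT) * n.+1%:R)).+1.
have [A AD mA] := infinite_set_fset m infD.
have : \esum_(j in D_ n) nu (F j) <= nu setT.
  apply: esum_trivIset_le; first by move=> j [/mF].
  by apply: sub_trivIset tF => j [].
apply/negP; rewrite -ltNge.
have h1 : \sum_(j \in [set` A]) nu (F j) <= \esum_(j in D_ n) nu (F j).
  by apply: ereal_sup_ubound; exists [set` A].
have h2 : \sum_(j \in [set` A]) (n.+1%:R^-1 : R)%:E <= \sum_(j \in [set` A]) nu (F j).
  by apply: lee_fsum; [exact: finite_fset|move=> j /AD[]].
apply: (lt_le_trans _ h1); apply: (lt_le_trans _ h2).
rewrite fsbig_finite//= set_fsetK sumEFin big_const_seq iter_addr addr0.
rewrite count_predT -[nu setT]fineK// lte_fin -[ltRHS]mulr_natl.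
rewrite ltr_pdivlMr// (lt_le_trans (truncnS_gt _))// ler_nat.
exact: mA.
Qed.

End disjoint_families.

(** * Euclidean norm, Poisson kernel and balls *)

Section euclidean_norm.
Context {R : realType} {n : nat}.
Implicit Types x y : 'rV[R]_n.

Lemma enormZ (a : R) x : enorm (a *: x) = `|a| * enorm x.
Proof.
rewrite /enorm -sqrtr_sqr -sqrtrM ?sqr_ge0//; congr Num.sqrt.
by rewrite mulr_sumr; apply: eq_bigr => i _; rewrite mxE exprMn.
Qed.

Lemma enorm_distC x y : enorm (x - y) = enorm (y - x).
Proof. by rewrite -enormN opprB. Qed.

Lemma ler_enormB x y : `|enorm x - enorm y| <= enorm (x - y).
Proof.
rewrite ler_norml; apply/andP; split.
  rewrite lerNl opprB lerBlDr enorm_distC.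
  by rewrite (le_trans _ (ler_enormD _ _))// subrK.
by rewrite lerBlDr (le_trans _ (ler_enormD _ _))// subrK.
Qed.

End euclidean_norm.

Section poisson_kernel_bounds.
Context {R : realType} {d : nat}.
Implicit Types y xi : sphere R d.

Lemma enorm_sphere y : enorm (val y) = 1.
Proof. by case: y => x /= /eqP. Qed.

Lemma enorm_scale_sphere (r : R) y : 0 <= r -> enorm (r *: val y) = r.
Proof. by move=> r0; rewrite enormZ enorm_sphere mulr1 ger0_norm. Qed.

Lemma enorm_radial_ge (r : R) y xi : 0 <= r ->
  1 - r <= enorm (r *: val y - val xi).
Proof.
move=> r0; rewrite enorm_distC (le_trans _ (ler_enormB _ _))//.
by rewrite enorm_sphere enorm_scale_sphere// ler_norm.
Qed.

(** The point r y is at distance 1 - r from y, which by [enorm_radial_ge] is at most its distance to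
    xi. *)
Lemma mdist_radial_le (r : R) y xi : 0 <= r <= 1 ->
  mdist y xi <= 2 * enorm (r *: val y - val xi).
Proof.
move=> /andP[r0 r1].
have -> : mdist y xi = enorm ((val y - r *: val y) + (r *: val y - val xi)).
  by rewrite addrA subrK.
apply: le_trans (ler_enormD _ _) _.
have -> : val y - r *: val y = (1 - r) *: val y.
  by rewrite scalerBl scale1r.
rewrite enorm_scale_sphere ?subr_ge0//.
by have := enorm_radial_ge _ y xi r0; lra.
Qed.

Lemma poisson_kernel_ge0 (x : 'rV[R]_d.+1) xi :
  enorm x <= 1 -> 0 <= poisson_kernel x xi.
Proof.
move=> x1; rewrite /poisson_kernel divr_ge0 ?exprn_ge0 ?enorm_ge0//.
by rewrite subr_ge0 exprn_ile1 ?enorm_ge0.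
Qed.

Lemma poisson_kernel_le (s u : R) y xi : 0 < s <= 1 -> 0 < u ->
  u <= enorm ((1 - s) *: val y - val xi) ->
  poisson_kernel ((1 - s) *: val y) xi <= 2 * s / u ^+ d.+1.
Proof.
move=> /andP[s0 s1] u0 ux; rewrite /poisson_kernel enorm_scale_sphere ?subr_ge0//.
apply: ler_pM.
- by rewrite subr_ge0 exprn_ile1// ?subr_ge0// lerBlDr lerDl ltW.
- by rewrite invr_ge0 exprn_ge0 ?enorm_ge0.
- by have := sqr_ge0 s; lra.
- rewrite lef_pV2 ?posrE ?exprn_gt0//; last exact: lt_le_trans ux.
  by rewrite lerXn2r ?nnegrE ?enorm_ge0 ?(ltW u0).
Qed.

(* The ball of the index [k] that is picked is the first one to contain [xi],
   hence [|x - xi| >= 2 ^ k s / 4]. *)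
Lemma poisson_kernel_dyadic (s : R) y xi : 0 < s <= 1 ->
  exists2 k : nat, ball y (2 ^+ k * s) xi &
    poisson_kernel ((1 - s) *: val y) xi <=
      2 * 4 ^+ d.+1 / (2 ^+ k * (2 ^+ k * s) ^+ d).
Proof.
move=> /andP[s0 s1].
have [k0 hk0] : exists k : nat, mdist y xi < 2 ^+ k * s.
  exists (Num.trunc (mdist y xi / s)).+1.
  rewrite -ltr_pdivrMr// (lt_le_trans (truncnS_gt _))//.
  by rewrite -natrX ler_nat ltnW// ltn_expl.
have := @ex_minnP _ (ex_intro (fun k => mdist y xi < 2 ^+ k * s) k0 hk0).
case=> k yk mink.
exists k; first by rewrite ballEmdist.
have r01 : 0 <= 1 - s <= 1 by rewrite subr_ge0 s1 lerBlDr lerDl ltW.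
have u0 : 0 < 2 ^+ k * s by rewrite mulr_gt0 ?exprn_gt0.
have ux : 2 ^+ k * s / 4 <= enorm ((1 - s) *: val y - val xi).
  (* For k = 0 the radial gap s suffices; otherwise minimality of k puts xi outside the preceding
     ball, and [mdist_radial_le] costs a factor 2. *)
  case: k => [|k] in yk mink u0 *.
    have := enorm_radial_ge (1 - s) y xi (andP r01).1.
    by rewrite expr0; lra.
  have := mdist_radial_le (1 - s) y xi r01.
  have : 2 ^+ k * s <= mdist y xi.
    by rewrite leNgt; apply/negP => /mink; rewrite ltnn.
  by rewrite exprS; lra.
apply: le_trans (poisson_kernel_le s (2 ^+ k * s / 4) y xi _ _ ux) _.
- by rewrite s0.
- by rewrite divr_gt0.
- rewrite exprMn exprVn le_eqVlt; apply/orP; left; apply/eqP.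
  rewrite [(2 ^+ k * s) ^+ d.+1]exprS.
  field.
  by rewrite !lt0r_neq0// ?exprn_gt0.
Qed.

Lemma continuous_enorm_sphere (x : 'rV[R]_d.+1) :
  continuous (fun xi : sphere R d => enorm (x - val xi)).
Proof.
move=> xi; have := @nbhs_filter (sphere R d) xi => FF.
apply/(cvgrPdist_lt (FF := FF)) => e e0.
apply: (@filterS _ (nbhs xi) _ _ _ _ (nbhsx_ballx xi e e0)) => z.
rewrite ballEmdist /= => xz; apply: le_lt_trans (ler_enormB _ _) _.
by rewrite opprB addrC addrA subrK enorm_distC.
Qed.

Lemma measurable_poisson_kernel (x : 'rV[R]_d.+1) : enorm x < 1 ->
  measurable_fun setT (poisson_kernel x : borel (sphere R d) -> R).
Proof.
move=> x1.
have ck : continuous (poisson_kernel x : sphere R d -> R).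
  move=> xi; have := @nbhs_filter (sphere R d) xi => FF.
  apply: cvgM; first exact: cvg_cst.
  apply: cvgV.
    rewrite expf_eq0/=; apply/eqP => xxi.
    have := ler_enormB x (val xi); rewrite xxi enorm_sphere normr_le0 subr_eq0.
    by rewrite lt_eqF.
  have cX := @exprn_continuous R d.+1 (enorm (x - val xi)).
  exact: (continuous_comp (@continuous_enorm_sphere x xi) cX).
apply: (measurability _ (RGenOInfty.measurableE R)) => //.
move=> _ [_ [a ->] <-]; rewrite setTI; apply: sub_sigma_algebra.
by move/continuousP : ck; apply; exact: interval_open.
Qed.

End poisson_kernel_bounds.

Lemma measurable_ball_borel {R : realType} {d : nat} (y : sphere R d) (r : R) :
  measurable (ball y r : set (borel (sphere R d))).
Proof.
apply: sub_sigma_algebra; rewrite openE => z yz.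
move: (yz); rewrite ballEmdist/= => dyz.
apply/nbhs_ballP; exists (r - mdist y z) => /=; first by rewrite subr_gt0.
move=> w; rewrite !ballEmdist/= => dzw.
by have := metric_triangle y z w; lra.
Qed.

(** * Domination of a complex measure by a finite positive one *)

Lemma normc_le {R : realType} (a b : R) :
  Normc.normc (a +i* b)%C <= `|a| + `|b|.
Proof.
rewrite /= -(ler_pXn2r (n := 2))// ?nnegrE ?sqrtr_ge0 ?addr_ge0//.
rewrite sqr_sqrtr ?addr_ge0 ?sqr_ge0// sqrrD !real_normK ?num_real//.
by rewrite lerD2r lerDl mulrn_wge0 ?mulr_ge0.
Qed.

Section dominating_measure.
Local Open Scope ereal_scope.
Context {d : measure_display} {T : measurableType d} {R : realType}.

Lemma charge_integral_dominated (nu : {charge set T -> \bar R}) :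
  exists v : {measure set T -> \bar R}, v setT < +oo /\
    forall f : T -> R, measurable_fun setT f -> (forall x, 0 <= f x)%R ->
      `|charge_integral nu f|%:E <= \int[v]_x (f x)%:E.
Proof.
(* These are the choices made inside [charge_integral], which thus unfolds to a difference of
   integrals against the same two Jordan parts. *)
pose P := cid (Hahn_decomposition nu); pose N := cid (svalP P).
exists (measure_add (jordan_pos (svalP N)) (jordan_neg (svalP N))); split.
  by rewrite [ltLHS]measure_addE lte_add_pinfty// ltey_eq fin_num_measure//.
move=> f mf f0; rewrite ge0_integral_measure_add//; last 2 first.
- by move=> x _; rewrite lee_fin.
- exact/measurable_EFinP.
(* The real integral is [fine] of the extended one, hence 0 if that is infinite; the inequality
   survives this default. *)
have fineE (v : {measure set T -> \bar R}) :
    (\int[v]_x f x)%:E <= \int[v]_x (f x)%:E /\ (0 <= \int[v]_x f x)%R.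
  have I0 : 0 <= \int[v]_x (f x)%:E.
    by apply: integral_ge0 => x _; rewrite lee_fin.
  split; last exact: fine_ge0.
  rewrite /Rintegral; case: (\int[v]_x (f x)%:E) I0 => //= _; exact: leey.
rewrite /charge_integral -/P -/N.
have [pos pos0] := fineE (jordan_pos (svalP N)).
have [neg neg0] := fineE (jordan_neg (svalP N)).
apply: le_trans (leeD pos neg); rewrite -EFinD lee_fin.
by rewrite (le_trans (ler_normB _ _))// !ger0_norm.
Qed.

Lemma complex_integral_dominated (mu : complex_measure T R) :
  exists v : {measure set T -> \bar R}, v setT < +oo /\
    forall f : T -> R, measurable_fun setT f -> (forall x, 0 <= f x)%R ->
      (Normc.normc (complex_integral mu f))%:E <= \int[v]_x (f x)%:E.
Proof.
have [v1 [v1oo v1le]] := charge_integral_dominated (re_part mu).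
have [v2 [v2oo v2le]] := charge_integral_dominated (im_part mu).
exists (measure_add v1 v2); split.
  by rewrite [ltLHS]measure_addE lte_add_pinfty.
move=> f mf f0; rewrite ge0_integral_measure_add//; last 2 first.
- by move=> x _; rewrite lee_fin.
- exact/measurable_EFinP.
apply: le_trans (leeD (v1le f mf f0) (v2le f mf f0)).
by rewrite -EFinD lee_fin; exact: normc_le.
Qed.

End dominating_measure.

(** * Poisson integrals and balls of large mass *)

Lemma integral_poisson_kernel_le {R : realType} {d : nat}
    (nu : {measure set (borel (sphere R d)) -> \bar R}) (s L : R)
    (y : sphere R d) : 0 < s <= 1 -> 0 <= L ->
  (forall k : nat,
    nu (ball y (2 ^+ k * s)) <= (L * (2 ^+ k * s) ^+ d)%:E)%E ->
  (\int[nu]_xi (poisson_kernel ((1 - s) *: val y) xi)%:E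
    <= (4 ^+ d.+2 * L)%:E)%E.
Proof.
move=> s01 L0 nuL; have /andP[s0 s1] := s01.
pose A : R := 2 * 4 ^+ d.+1.
pose a k : R := A / (2 ^+ k * (2 ^+ k * s) ^+ d).
have A0 : 0 <= A by rewrite mulr_ge0 ?exprn_ge0.
have u0 k : 0 < (2 ^+ k * s) ^+ d.
  by rewrite exprn_gt0 ?mulr_gt0 ?exprn_gt0.
have a0 k : 0 <= a k.
  by rewrite divr_ge0// mulr_ge0 ?exprn_ge0// ?mulr_ge0 ?exprn_ge0// ltW.
have mB k : measurable (ball y (2 ^+ k * s) : set (borel (sphere R d))).
  exact: measurable_ball_borel.
pose g k (xi : borel (sphere R d)) : \bar R :=
  ((a k)%:E * (\1_(ball y (2 ^+ k * s)) xi)%:E)%E.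
have g0 k xi : (0 <= g k xi)%E by rewrite mule_ge0 ?lee_fin.
have mind k : measurable_fun setT
    (fun xi : borel (sphere R d) => (\1_(ball y (2 ^+ k * s)) xi : R)%:E).
  by apply/measurable_EFinP; exact: measurable_indic.
have mg k : measurable_fun setT (g k) by exact: measurable_funeM.
have ny : enorm ((1 - s) *: val y) < 1.
  by rewrite enorm_scale_sphere ?subr_ge0//; lra.
(* The factor (2^k s)^d cancels against the weight [a k], leaving 2 * 4^(d+1) L / 2^k, written in
   the form summed by [epsilon_trick0]. *)
have intg k : (\int[nu]_xi g k xi <= ((4 ^+ d.+2 * L) / (2 ^ k.+1)%:R)%:E)%E.
  rewrite /g ge0_integralZl_EFin//.
  rewrite integral_indic// setIT.
  apply: le_trans (lee_wpmul2l _ (nuL k)) _; first by rewrite lee_fin.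
  rewrite -EFinM lee_fin /a /A natrX !exprS le_eqVlt; apply/orP; left; apply/eqP.
  by field; rewrite !lt0r_neq0// exprn_gt0.
apply: (@le_trans _ _ (\int[nu]_xi \sum_(k <oo) g k xi)%E).
  apply: ge0_le_integral => //.
  - by move=> xi _; rewrite lee_fin poisson_kernel_ge0// ltW.
  - by apply/measurable_EFinP; exact: measurable_poisson_kernel.
  - exact: ge0_emeasurable_sum.
  - move=> xi _; have [k yk Pk] := poisson_kernel_dyadic s y xi s01.
    rewrite (@nneseriesD1 _ _ k)//.
    apply: (@le_trans _ _ (g k xi)).
      by rewrite /g indicE mem_set// mule1 lee_fin.
    by rewrite leeDl// nneseries_ge0.
rewrite integral_nneseries//.
apply: le_trans (epsilon_trick0 xpredT _); last by rewrite mulr_ge0 ?exprn_ge0.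
by apply: lee_nneseries => [k _ _|k _]; [exact: integral_ge0|exact: intg].
Qed.

Lemma divergence_set_dense_ball {R : realType} {d : nat} (hd : (1 <= d)%N)
    (mu : complex_measure (borel (sphere R d)) R)
    (nu : {measure set (borel (sphere R d)) -> \bar R}) (tau : R -> R)
    (M delta : R) (y : sphere R d) :
  (nu setT < +oo)%E ->
  (forall f : borel (sphere R d) -> R, measurable_fun setT f ->
    (forall x, 0 <= f x) ->
    ((Normc.normc (complex_integral mu f))%:E <= \int[nu]_x (f x)%:E)%E) ->
  {in `]0, 1[, forall x, 0 < tau x} ->
  {in `]0, 1[ &, nonincreasing_fun tau} ->
  tau x @[x --> 0^'+] --> +oo ->
  0 < M -> 0 < delta <= 1 -> divergence_set tau mu y ->
  exists rho, [/\ 0 < rho, rho < delta &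
    ((M * tau rho * rho ^+ d)%:E < nu (ball y rho))%E].
Proof.
move=> nuoo nule tau0 taui tauoo M0 /andP[delta0 delta1] yE.
have nufin : nu setT \is a fin_num by rewrite ge0_fin_numE.
pose W := fine (nu setT).
(* Beyond this threshold M tau(s) delta^d exceeds the total mass, which later forces rho < delta. *)
have [e /= e0 tauW] : \forall s \near 0^'+, W / (M * delta ^+ d) < tau s.
  by move/cvgryPgt : tauoo; exact.
pose V := [set r : R | Num.max (1 - e) 0 < r < 1].
have nV : (1 : R)^'- V.
  near=> r; rewrite /V/=; apply/andP; split; near: r.
    by apply: nbhs_left_gt; rewrite gt_max; apply/andP; split => //; lra.
  exact: nbhs_left_lt.
(* [limf_esup] is an infimum of suprema over neighbourhoods, and [V] is one of them. *)
have supV : ereal_sup ((fun r : R =>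
    (Normc.normc (poisson mu (r *: val y)) / tau (1 - r))%:E) @` V) = +oo%E.
  apply/eqP; rewrite -leye_eq -yE; apply: ereal_inf_lbound.
  by exists V.
(* 4^(d+2) is the constant of [integral_poisson_kernel_le]: with L = M tau(s), small mass in all
   dyadic balls would contradict the choice of r. *)
have [_ [r Vr <-] Kr] : exists2 z, ((fun r : R =>
    (Normc.normc (poisson mu (r *: val y)) / tau (1 - r))%:E) @` V) z &
    ((4 ^+ d.+2 * M)%:E < z)%E.
  by apply: ereal_sup_gt; rewrite supV ltry.
move: Vr Kr; rewrite /V/= gt_max lte_fin => /andP[/andP[er r0] r1] Kr.
pose s := 1 - r.
have rs : r = 1 - s by rewrite /s; lra.
have s01 : s \in `]0, 1[ by rewrite in_itv/= /s; apply/andP; split; lra.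
have taus : 0 < tau s := tau0 _ s01.
have tauWs : W / (M * delta ^+ d) < tau s.
  apply: tauW; rewrite /s; last by rewrite subr_gt0.
  by rewrite /= sub0r normrN gtr0_norm; lra.
have [k Mk] : exists k : nat,
    ((M * tau s * (2 ^+ k * s) ^+ d)%:E < nu (ball y (2 ^+ k * s)))%E.
  apply: contrapT => /forallNP Nk.
  have s01' : 0 < s <= 1.
    by move: s01; rewrite in_itv/= => /andP[-> /ltW].
  have ny : enorm (r *: val y) < 1 by rewrite enorm_scale_sphere// ltW.
  have Mt0 : 0 <= M * tau s by rewrite mulr_ge0 ?ltW.
  have := integral_poisson_kernel_le nu s (M * tau s) y s01' Mt0.
  rewrite -rs => /(_ _)/wrap[k|]; first by rewrite leNgt; apply/negP; exact: Nk.
  apply/negP; rewrite -ltNge.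
  apply: lt_le_trans (nule _ (measurable_poisson_kernel _ ny) _); last first.
    by move=> xi; rewrite poisson_kernel_ge0// ltW.
  by rewrite lte_fin mulrA -ltr_pdivlMr.
pose rho := 2 ^+ k * s.
have s0 : 0 < s by rewrite /s subr_gt0.
have rho0 : 0 < rho by rewrite mulr_gt0// exprn_gt0.
have rhod : rho < delta.
  (* M tau(s) rho^d < [W] < M tau(s) delta^d; extracting d-th roots requires d >= 1. *)
  rewrite -(@ltr_pXn2r _ d)// ?nnegrE ?ltW//.
  have : (M * tau s * rho ^+ d < W).
    rewrite -lte_fin fineK//; apply: lt_le_trans Mk _.
    by apply: le_measure => //; apply/mem_set => //; exact: measurable_ball_borel.
  move: tauWs; rewrite ltr_pdivrMr ?mulr_gt0 ?exprn_gt0// => h1 h2.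
  have := lt_trans h2 h1.
  by rewrite mulrCA mulrA ltr_pM2l// mulr_gt0.
exists rho; split => //.
apply: le_lt_trans Mk; rewrite lee_fin ler_wpM2r ?exprn_ge0 ?(ltW rho0)//.
rewrite ler_pM2l//; apply: taui => //.
  by rewrite in_itv/= rho0 (lt_le_trans rhod).
by rewrite ler_peMl ?(ltW s0)// exprn_ege1// ler1n.
Unshelve. all: by end_near.
Qed.

(** * Covering by dilated balls *)

Lemma diameter_ball {R : realType} {T : metricType R} (x : T) (r : R) :
  0 < r -> 0 <= diameter (ball x r) <= 2 * r.
Proof.
move=> r0; rewrite /diameter; set S := (X in sup X).
have xx : ball x r x by rewrite ballEmdist/= mdistxx.
have Sub : ubound S (2 * r).
  move=> _ [y /= yx [z /= zx <-]]; move: yx zx; rewrite !ballEmdist/= => xy xz.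
  by have := metric_triangle y x z; rewrite (metric_sym y x); lra.
have S0 : S 0 by exists x => //; exists x => //; exact: mdistxx.
apply/andP; split; last by apply: ge_sup => //; exists 0.
by apply: sup_upper_bound => //; split; [exists 0|exists (2 * r)].
Qed.

(** The factor 6 bounds the diameter of a threefold dilation; disjointness of the original balls
    bounds the sum by the total mass. *)
Lemma hausdorff_premeasure_le_mass {R : realType} {d : nat}
    (nu : {measure set (borel (sphere R d)) -> \bar R}) (phi : R -> R)
    (eps delta : R) (E : set (sphere R d)) :
  (nu setT < +oo)%E -> dimension_function phi -> 6 * delta <= eps ->
  (forall y, E y -> exists rho, [/\ 0 < rho, rho < delta &
    ((phi (6 * rho))%:E < nu (ball y rho))%E]) ->
  (hausdorff_premeasure phi eps E <= nu setT)%E.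
Proof.
move=> nuoo [_ phi_homo phi_ge0 _] deps dense.
pose V := [set p : sphere R d * R | [/\ 0 < p.2, p.2 < delta &
  ((phi (6 * p.2))%:E < nu (ball p.1 p.2))%E]].
pose B (p : sphere R d * R) := ball p.1 p.2.
have [G [GV tG coverG]] : exists G : set (sphere R d * R), [/\ G `<=` V,
    trivIset G B & forall i, V i ->
      exists j, [/\ G j, B i `&` B j !=set0 & i.2 <= 2 * j.2]].
  apply: (@vitali_selection _ _ _ B snd V delta).
  - move=> p [p0 _ _]; exists p.1; rewrite /B ballEmdist/=.
    by rewrite mdistxx.
  - by move=> p [].
  - by move=> p [_ /ltW].
pose C := [set ball p.1 (3 * p.2) | p in G].
(* Coverings are sets of balls, so [g] picks one pair of [G] for each member of [C]; distinct
   members get distinct pairs, hence disjoint balls. Outside [C] the value is a placeholder. *)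
have /choice[g gP] : forall A, exists p : sphere R d * R,
    C A -> G p /\ ball p.1 (3 * p.2) = A.
  move=> A.
  have [[p Gp <-]|NC] := pselect (C A); first by exists p.
  by exists (north_pole, 0) => /NC.
have mB p : measurable (B p : set (borel (sphere R d))).
  exact: measurable_ball_borel.
have tC : trivIset C (B \o g).
  move=> A1 A2 CA1 CA2 /= BB.
  have [G1 <-] := gP _ CA1; have [G2 <-] := gP _ CA2.
  by rewrite (tG _ _ G1 G2 BB).
have diamC A : C A -> [/\ 0 <= diameter A, diameter A <= eps &
    ((phi (diameter A))%:E <= nu (B (g A)))%E].
  move=> CA; have [/GV[p0 pd phinu] gA] := gP _ CA.
  have : 0 <= diameter A <= 2 * (3 * (g A).2).
    by rewrite -{1 2}gA; apply: diameter_ball; rewrite mulr_gt0.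
  move=> /andP[dA0 dA]; split => //; first by lra.
  apply/ltW/(le_lt_trans _ phinu); rewrite lee_fin.
  by apply: phi_homo; rewrite ?in_itv/= ?dA0//; lra.
apply: (@le_trans _ _ (\esum_(A in C) (phi (diameter A))%:E)%E).
  apply: ereal_inf_lbound; exists C => //; split.
  (* The strict bound phi(6 rho) < nu(B) makes the mass of each selected ball positive. *)
  - apply: (countable_trivIset nu C (B \o g)) => //= A CA.
    have [/GV[p0 pd phinu] _] := gP _ CA.
    apply: le_lt_trans phinu; rewrite lee_fin phi_ge0// in_itv/= andbT.
    by rewrite mulr_ge0// ltW.
  - move=> A CA; split; last by have [] := diamC _ CA.
    have [/GV[p0 _ _] <-] := gP _ CA.
    by exists (g A).1, (3 * (g A).2); split => //; rewrite mulr_gt0.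
  (* When the balls around y and z meet, the centres are within rho + sigma <= 3 sigma, because rho
     <= 2 sigma. *)
  - move=> y Ey; have [rho [rho0 rhod phirho]] := dense _ Ey.
    have [[z sigma] [Gz [w []]]] := coverG (y, rho) (And3 rho0 rhod phirho).
    rewrite /B !ballEmdist/= => yw zw rs.
    exists (ball z (3 * sigma)); first by exists (z, sigma).
    rewrite ballEmdist/=.
    by have := metric_triangle z w y; rewrite (metric_sym w y); lra.
apply: le_trans (esum_trivIset_le nu C (B \o g) _ tC); last first.
  by move=> A _; exact: mB.
by apply: le_esum => A /diamC[].
Qed.

(** * Vanishing of the Hausdorff measure *)

Theorem theorem3 (R : realType) (d : nat) (hd : (1 <= d)%N)
    (mu : complex_measure (borel (sphere R d)) R)
    (tau : R -> R)
    (tau_gt0 : {in `]0, 1[, forall x, 0 < tau x})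
    (tau_noninc : {in `]0, 1[ &, nonincreasing_fun tau})
    (tau_lim : tau x @[x --> 0^'+] --> +oo)
    (phi : R -> R)
    (phi_dim : dimension_function phi)
    (phi_gt0 : forall s, 0 < s -> 0 < phi s)
    (phi_bigO : (phi : R -> R^o) =O_ (0^'+) (fun s => tau s * s ^+ d : R^o)) :
  hausdorff_measure phi (divergence_set tau mu) = 0%E.
Proof.
have [nu [nuoo nule]] := complex_integral_dominated mu.
have nufin : nu setT \is a fin_num by rewrite ge0_fin_numE.
pose W := fine (nu setT).
have W0 : 0 <= W by exact: fine_ge0.
have [K K0 [e /= e0 phiK]] := (eqO_exP _ _ _).1 phi_bigO.
have phi_ge0 : {in `[0, +oo[, forall s, 0 <= phi s} by case: phi_dim.
(* The premeasure is already 0 for each eps > 0: it is nonnegative and at most any eta > 0. *)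
apply: lim_near_cst => //; near=> eps.
have eps0 : 0 < eps by near: eps; exact: nbhs_right_gt.
apply/eqP; rewrite eq_le; apply/andP; split; last first.
  apply: le_ereal_inf_tmp => _ [C [_ Cball _] <-]; apply: esum_ge0 => A CA.
  have [[x [r [r0 ->]]] _] := Cball _ CA.
  rewrite lee_fin phi_ge0// in_itv/= andbT.
  by have /andP[] := diameter_ball x r r0.
apply/lee_addgt0Pr => eta eta0; rewrite add0e.
(* The measure c nu has mass c W <= eta; adding 1 keeps the denominator positive when [W] is 0. *)
pose c := eta / (W + 1).
have c0 : 0 < c by rewrite divr_gt0// ltr_wpDl.
(* Chosen so that c M tau(rho) rho^d = K tau(rho) (6 rho)^d, which dominates phi(6 rho). *)
pose M := K * 6 ^+ d / c.
have M0 : 0 < M by rewrite divr_gt0// mulr_gt0// exprn_gt0.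
(* For rho < delta, 6 rho stays below 1, where [tau] is monotone, below eps for the covering, and
   below e for the O-bound. *)
pose delta := Num.min (Num.min 1 eps) e / 6.
have m0 : 0 < Num.min (Num.min 1 eps) e by rewrite !lt_min ltr01 eps0 e0.
have [d1 deps de] : [/\ 6 * delta <= 1, 6 * delta <= eps & 6 * delta <= e].
  have -> : 6 * delta = Num.min (Num.min 1 eps) e by rewrite /delta; field.
  by split; rewrite !ge_min lexx ?orbT.
have delta0 : 0 < delta by rewrite divr_gt0.
pose nuc := mscale (NngNum (ltW c0)) nu.
have nucT : nuc setT = (c * W)%:E by rewrite EFinM /W fineK.
apply: (@le_trans _ _ (nuc setT)).
  apply: (hausdorff_premeasure_le_mass _ phi eps delta) => //.
    by have := ltry (c * W); rewrite -nucT.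
  move=> y Ey.
  have d01 : 0 < delta <= 1 by rewrite delta0; lra.
  have [rho [rho0 rhod nurho]] := divergence_set_dense_ball hd mu nu tau M delta
    y nuoo nule tau_gt0 tau_noninc tau_lim M0 d01 Ey.
  exists rho; split => //.
  have r6 : 6 * rho \in `]0, 1[ by rewrite in_itv/=; apply/andP; split; lra.
  have r1 : rho \in `]0, 1[ by rewrite in_itv/=; apply/andP; split; lra.
  have tau6 : tau (6 * rho) <= tau rho by apply: tau_noninc => //; lra.
  have phi6 : phi (6 * rho) <= K * (tau (6 * rho) * (6 * rho) ^+ d).
    apply: le_trans (ler_norm _) _.
    rewrite -[leRHS]ger0_norm; last first.
      by rewrite !mulr_ge0 ?exprn_ge0 ?mulr_ge0 ?(ltW (tau_gt0 _ r6)) ?ltW.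
    rewrite normrM (gtr0_norm K0); apply: phiK => /=; last by rewrite mulr_gt0.
    by rewrite sub0r normrN gtr0_norm ?mulr_gt0//; lra.
  have : (c%:E * (M * tau rho * rho ^+ d)%:E < nuc (ball y rho))%E.
    by rewrite /nuc /mscale/= lte_pmul2l.
  apply: le_lt_trans; rewrite -EFinM lee_fin; apply: le_trans phi6 _.
  have -> : c * (M * tau rho * rho ^+ d) = K * (tau rho * (6 * rho) ^+ d).
    by rewrite /M exprMn; field; rewrite lt0r_neq0.
  by rewrite ler_pM2l// ler_wpM2r// exprn_ge0// mulr_ge0// ltW.
rewrite nucT lee_fin /c.
by rewrite mulrAC ler_pdivrMr ?ltr_wpDl// ler_pM2l// lerDl.
Unshelve. all: by end_near.
Qed.
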